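(* Let $\nu>0$, $p>0$ and $\alpha,\beta\in\mathbb{R}$ be such that $(\nu,p,\alpha,\beta)$ is admissible for the ECOMP distribution (either $\alpha>\beta$, or $\alpha=\beta$ and $p<1$) and $(\nu,p,\beta)$ is admissible for the GCOMP distribution (either $\beta<1$, or $\beta=1$ and $p<1$). Let $X\sim\mathrm{ECOMP}(\nu,p,\alpha,\beta)$ and $Y\sim\mathrm{GCOMP}(\nu,p,\beta)$. If $\alpha>1$, then $X$ is smaller than $Y$ in the likelihood ratio order, i.e. $X\le_{lr}Y$.
   Context: $(\nu)_k=\nu(\nu+1)\cdots(\nu+k-1)$, with $(\nu)_0=1$, is the Pochhammer symbol. The extended Conway-Maxwell-Poisson distribution $\mathrm{ECOMP}(\nu,p,\alpha,\beta)$ is the distribution on $\{0,1,2,\dots\}$ with probability mass function $P(X=k)=\frac{\{(\nu)_k\}^{\beta}}{(k!)^{\alpha}}p^k\big/\sum_{i=0}^{\infty}\frac{\{(\nu)_i\}^{\beta}}{(i!)^{\alpha}}p^i$. The generalized Conway-Maxwell-Poisson distribution $\mathrm{GCOMP}(\nu,p,\beta)$ is the distribution on $\{0,1,2,\dots\}$ with probability mass function $P(Y=k)=\frac{\{\Gamma(\nu+k)\}^{\beta}}{k!}p^k\big/\sum_{i=0}^{\infty}\frac{\{\Gamma(\nu+i)\}^{\beta}}{i!}p^i$. For random variables $X,Y$ on $\{0,1,2,\dots\}$ with everywhere positive probability mass functions, $X\le_{lr}Y$ (likelihood ratio order) means that $n\mapsto P(Y=n)/P(X=n)$ is nondecreasing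 on $\{0,1,2,\dots\}$. *)

(* Defs.v *)
From HB Require Import structures.
From mathcomp Require Import all_boot all_order all_algebra.
From mathcomp Require Import all_classical all_reals all_analysis.

Set Implicit Arguments.
Unset Strict Implicit.
Unset Printing Implicit Defensive.

Import Order.TTheory GRing.Theory Num.Theory.
Import numFieldNormedType.Exports.

Local Open Scope classical_set_scope.
Local Open Scope ring_scope.

Definition pochhammer (R : realType) (nu : R) (k : nat) : R :=
  \prod_(i < k) (nu + i%:R).

(* Euler's integral, meaningful for 0 < x only. *)
Definition Gamma (R : realType) (x : R) : R :=
  \int[lebesgue_measure]_(t in `]0, +oo[) (t `^ (x - 1) * expR (- t)).

(* The normalizing sums below are limits of partial sums, and the admissibility
   conditions on the parameters are what makes these partial sums converge. *)
Definition ecomp_weight (R : realType) (nu p alpha beta : R) (k : nat) : R :=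
  pochhammer nu k `^ beta / k`!%:R `^ alpha * p ^+ k.

Definition ecomp_pmf (R : realType) (nu p alpha beta : R) (k : nat) : R :=
  ecomp_weight nu p alpha beta k / limn (series (ecomp_weight nu p alpha beta)).

Definition gcomp_weight (R : realType) (nu p beta : R) (k : nat) : R :=
  Gamma (nu + k%:R) `^ beta / k`!%:R * p ^+ k.

Definition gcomp_pmf (R : realType) (nu p beta : R) (k : nat) : R :=
  gcomp_weight nu p beta k / limn (series (gcomp_weight nu p beta)).

(* Counterpart for nat-valued variables of the library's pmf, which is
   restricted to real-valued ones. *)
Definition npmf (d : measure_display) (T : measurableType d) (R : realType)
    (P : probability T R) (X : {RV P >-> nat}) (k : nat) : R :=
  fine (P (X @^-1` [set k])).

Definition has_ecomp_law (d : measure_display) (T : measurableType d)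
    (R : realType) (P : probability T R) (X : {RV P >-> nat})
    (nu p alpha beta : R) : Prop :=
  forall k, npmf X k = ecomp_pmf nu p alpha beta k.

Definition has_gcomp_law (d : measure_display) (T : measurableType d)
    (R : realType) (P : probability T R) (X : {RV P >-> nat})
    (nu p beta : R) : Prop :=
  forall k, npmf X k = gcomp_pmf nu p beta k.

(* The order only compares variables with everywhere positive mass functions,
   so positivity is part of the relation; X and Y may live on different
   probability spaces. *)
Definition lr_le (d1 d2 : measure_display) (T1 : measurableType d1)
    (T2 : measurableType d2) (R : realType) (P1 : probability T1 R)
    (P2 : probability T2 R) (X : {RV P1 >-> nat}) (Y : {RV P2 >-> nat}) : Prop :=
  [/\ forall n, 0 < npmf X n,
      forall n, 0 < npmf Y n &
      {homo (fun n => npmf Y n / npmf X n) : m n / (m <= n)%N >-> m <= n}].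

(* Main.v *)
(** Iterating Gamma (x + 1) = x Gamma x gives Gamma (nu + k) = (nu)_k Gamma nu,
    so the likelihood ratio P(Y = k) / P(X = k) is a positive constant times
    (k!)^(alpha - 1), which is nondecreasing in k as soon as alpha >= 1.  The
    functional equation and the convergence of Euler's integral both come from
    integrating by parts on [1/n, n] and letting n tend to infinity. *)
Require Import Defs.
From HB Require Import structures.
From mathcomp Require Import all_boot all_order all_algebra.
From mathcomp Require Import all_classical all_reals all_analysis.
From mathcomp Require Import measurable_realfun ring lra.

Import Order.TTheory GRing.Theory Num.Theory.
Import numFieldNormedType.Exports.

Local Open Scope classical_set_scope.
Local Open Scope ring_scope.

(** * The integrand of Euler's integral on compact subintervals of the positive half-line *)

Definition gamma_fun {R : realType} (x t : R) : R := t `^ (x - 1) * expR (- t).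

Lemma gamma_fun_ge0 {R : realType} (x t : R) : 0 <= gamma_fun x t.
Proof. by rewrite mulr_ge0 ?powR_ge0 ?expR_ge0. Qed.

Lemma continuous_gamma_fun {R : realType} (x t : R) :
  0 < t -> {for t, continuous (gamma_fun x)}.
Proof.
move=> t0; apply: continuousM.
  apply/differentiable_continuous/derivable1_diffP.
  by apply: derivable_powR; rewrite in_itv/= t0.
apply: continuous_comp; first exact: opp_continuous.
exact: continuous_expR.
Qed.

Lemma continuous_in_within_itvcc {R : realType} (f : R -> R) (a b : R) :
  0 < a -> (forall t, 0 < t -> {for t, continuous f}) ->
  {within `[a, b], continuous f}.
Proof.
move=> a0 cf; apply: continuous_in_subspaceT => t.
by rewrite inE/= in_itv/= => /andP[at_ _]; apply: cf; exact: lt_le_trans at_.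
Qed.

Lemma integrable_itvcc {R : realType} (f : R -> R) (a b : R) :
  0 < a -> (forall t, 0 < t -> {for t, continuous f}) ->
  (@lebesgue_measure R).-integrable `[a, b] (EFin \o f).
Proof.
move=> a0 cf; apply: continuous_compact_integrable; first exact: segment_compact.
exact: continuous_in_within_itvcc.
Qed.

(** Since [0 < a], regularity at every positive point covers both endpoints, and the one-sided
    conditions of [continuous_FTC2] follow from two-sided ones. *)
Lemma Rintegral_continuous_FTC2 {R : realType} (f F : R -> R) (a b : R) :
  0 < a < b -> (forall t : R, 0 < t -> {for t, continuous f}) ->
  (forall t : R, 0 < t -> is_derive t 1 F (f t)) ->
  \int[lebesgue_measure]_(t in `[a, b]) f t = F b - F a.
Proof.
move=> /andP[a0 ab] cf dF.
have cF (t : R) : 0 < t -> {for t, continuous F}.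
  move=> t0; apply/differentiable_continuous/derivable1_diffP.
  by have [] := dF _ t0.
rewrite /Rintegral (continuous_FTC2 (F := F) ab)//.
- exact: continuous_in_within_itvcc.
- split.
  + move=> t; rewrite in_itv/= => /andP[at_ _].
    by have [] := dF _ (lt_trans a0 at_).
  + by apply: cvg_at_right_filter; exact: cF.
  + by apply: cvg_at_left_filter; apply: cF; exact: lt_trans ab.
- move=> t; rewrite in_itv/= => /andP[at_ _]; rewrite derive1E.
  by have [_] := dF _ (lt_trans a0 at_).
Qed.

(** * Decay, derivative and boundary limits of the integrand *)

(** With u = t / (2x), raise u <= 1 + u <= e^u to the power x; the scale 2x is chosen so that u x =
    t / 2, half of the available exponential decay. *)
Lemma powR_le_expR_half {R : realType} (x t : R) : 0 < x -> 0 <= t ->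
  t `^ x <= (2 * x) `^ x * expR (t / 2).
Proof.
move=> x0 t0; have y0 : 0 < 2 * x by rewrite mulr_gt0.
have {1}-> : t = (2 * x) * (t / (2 * x)) by rewrite mulrC divfK// gt_eqF.
rewrite powRM ?divr_ge0 ?(ltW y0)//; apply: ler_wpM2l; first exact: powR_ge0.
have -> : t / 2 = t / (2 * x) * x.
  by field; rewrite gt_eqF.
rewrite expRM; apply: ge0_ler_powR; rewrite ?nnegrE ?expR_ge0 ?(ltW x0)//.
  by rewrite divr_ge0// ltW.
by apply: le_trans (expR_ge1Dx _); rewrite lerDr.
Qed.

Lemma gamma_fun_le {R : realType} (x t : R) : 0 < x -> 0 <= t ->
  gamma_fun (x + 1) t <= (2 * x) `^ x * expR (- (t / 2)).
Proof.
move=> x0 t0; rewrite /gamma_fun addrK.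
have -> : - (t / 2) = t / 2 + - t by field.
rewrite expRD mulrA; apply: ler_wpM2r; first exact: expR_ge0.
exact: powR_le_expR_half.
Qed.

(** Integration by parts in differential form: the product rule for t^x e^(-t). *)
Lemma is_derive_gamma_fun {R : realType} (x t : R) : 0 < t ->
  is_derive t 1 (gamma_fun (x + 1)) (x * gamma_fun x t - gamma_fun (x + 1) t).
Proof.
move=> t0; rewrite /gamma_fun addrK.
have d1 := is_derive1_powR x t0.
apply: is_derive_eq.
rewrite /GRing.scale/=; ring.
Qed.

(** The exponential factor is at most 1, and t^x tends to 0 as t tends to 0 from the right because x
    > 0. *)
Lemma gamma_fun_cvg0 {R : realType} (x : R) : 0 < x ->
  gamma_fun (x + 1) n.+1%:R^-1 @[n --> \oo] --> (0 : R).
Proof.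
move=> x0.
apply: (@squeeze_cvgr _ _ _ _ (cst 0) (fun n : nat => n.+1%:R^-1 `^ x)).
- near=> n => /=; rewrite gamma_fun_ge0/= /gamma_fun addrK.
  by rewrite ler_piMr ?powR_ge0// expR_le1 oppr_le0.
- exact: cvg_cst.
- have /cvg_at_rightP := powR_cvg0 x0; apply; split=> [n|].
    by rewrite invr_gt0 ltr0n.
  exact: cvg_harmonic.
Unshelve. all: by end_near. Qed.

Lemma gamma_fun_cvgy {R : realType} (x : R) : 0 < x ->
  gamma_fun (x + 1) n.+1%:R @[n --> \oo] --> (0 : R).
Proof.
move=> x0.
apply: (@squeeze_cvgr _ _ _ _ (cst 0)
  (fun n : nat => (2 * x) `^ x * expR (- (n.+1%:R / 2)))).
- by near=> n => /=; rewrite gamma_fun_ge0/= gamma_fun_le.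
- exact: cvg_cst.
- have <- : (2 * x) `^ x * 0 = 0 by rewrite mulr0.
  apply: cvgM; first exact: cvg_cst.
  have h : expR (- (t / 2)) @[t --> +oo] --> (0 : R).
    apply: (@cvg_comp _ _ _ (fun t : R => t / 2) (fun t => expR (- t)) _
      (pinfty_nbhs R)); last exact: cvgr_expR.
    by apply: gt0_cvgMly => //; exact: cvg_id.
  apply: (cvg_comp _ _ _ h).
  by rewrite (cvg_shiftS (fun n => n%:R : R)); exact: cvgr_idn.
Unshelve. all: by end_near. Qed.

(** * Exhaustion of the positive half-line by compact intervals *)

(** The intervals stay away from 0, where t^(x - 1) blows up if x < 1. *)
Definition exhaust_itv (R : realType) (n : nat) : set R :=
  `[n.+1%:R^-1, n.+1%:R].

Lemma exhaust_itvE (R : realType) :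
  \bigcup_n exhaust_itv R n = `]0, +oo[%classic.
Proof.
apply/seteqP; split=> t /=.
  move=> [n _]; rewrite /exhaust_itv/= !in_itv/= andbT => /andP[+ _].
  by apply: lt_le_trans; rewrite invr_gt0 ltr0n.
rewrite in_itv/= andbT => t0.
(* Dominating both t and 1/t lets a single index control both endpoints. *)
pose m := Num.max t t^-1.
have m0 : 0 <= m by rewrite le_max (ltW t0).
exists (Num.truncn m) => //=; rewrite /exhaust_itv/= in_itv/=.
have mt := ltW (truncnS_gt m).
apply/andP; split; last by apply: le_trans mt; rewrite le_max lexx.
rewrite invf_ple ?posrE ?ltr0n//.
by apply: le_trans mt; rewrite le_max lexx orbT.
Qed.

Lemma nondecreasing_exhaust_itv (R : realType) :
  nondecreasing_seq (exhaust_itv R).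
Proof.
apply/nondecreasing_seqP => n; rewrite subsetEset /exhaust_itv.
apply: subset_itv; rewrite bnd_simp ?ler_nat//.
by rewrite lef_pV2 ?posrE ?ltr0n// ler_nat.
Qed.

Definition gamma_part {R : realType} (x : R) (n : nat) : R :=
  \int[lebesgue_measure]_(t in exhaust_itv R n) gamma_fun x t.

Lemma gamma_part_EFin {R : realType} (x : R) (n : nat) :
  (gamma_part x n)%:E =
  (\int[lebesgue_measure]_(t in exhaust_itv R n) (gamma_fun x t)%:E)%E.
Proof.
rewrite /gamma_part /Rintegral fineK//; apply: integrable_fin_num => //.
  exact: measurable_itv.
apply: integrable_itvcc; first by rewrite invr_gt0 ltr0n.
exact: continuous_gamma_fun.
Qed.

Lemma measurable_gamma_fun {R : realType} (x : R) (D : set R) :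
  measurable_fun D (gamma_fun x).
Proof.
apply: measurable_funTS; apply: measurable_funM => //.
exact: measurableT_comp.
Qed.

(** Monotone convergence for a nonnegative integrand; the limit is taken in the extended reals and
    may still be infinite here. *)
Lemma gamma_part_cvg_integral {R : realType} (x : R) :
  (gamma_part x n)%:E @[n --> \oo] -->
  (\int[lebesgue_measure]_(t in `]0%R, +oo[) (gamma_fun x t)%:E)%E.
Proof.
under eq_cvg do rewrite gamma_part_EFin.
rewrite -exhaust_itvE; apply: ge0_nondecreasing_set_cvg_integral.
- exact: nondecreasing_exhaust_itv.
- by move=> n; exact: measurable_itv.
- by move=> n; apply/measurable_EFinP; exact: measurable_gamma_fun.
- by move=> n t _; rewrite lee_fin gamma_fun_ge0.
Qed.

(** * Uniform bound and integration by parts on the compact intervals *)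

Lemma natSSinv_lt (R : realType) (n : nat) :
  (0 < n.+2%:R^-1 :> R) && (n.+2%:R^-1 < n.+2%:R :> R).
Proof.
rewrite invr_gt0 ltr0n/= (@lt_le_trans _ _ 1)// ?ler1n//.
by rewrite invf_lt1 ?ltr1n// ltr0n.
Qed.

Lemma is_derive_expR_half {R : realType} (t : R) :
  is_derive t 1 (fun s => - 2 * expR (- (s / 2))) (expR (- (t / 2))).
Proof.
by apply: is_derive_eq; rewrite /GRing.scale/=; field.
Qed.

(* The index n.+1 avoids exhaust_itv R 0, the degenerate interval [1, 1]. *)
Lemma gamma_part_succ_le {R : realType} (x : R) (n : nat) : 0 < x ->
  gamma_part (x + 1) n.+1 <= 2 * (2 * x) `^ x.
Proof.
move=> x0; have i0 : 0 < n.+2%:R^-1 :> R by rewrite invr_gt0 ltr0n.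
pose g t : R := expR (- (t / 2)).
have cg (t : R) : 0 < t -> {for t, continuous g}.
  move=> _; apply/differentiable_continuous/derivable1_diffP.
  exact: ex_derive.
have mI : measurable (exhaust_itv R n.+1) by exact: measurable_itv.
apply: (@le_trans _ _ (\int[lebesgue_measure]_(t in exhaust_itv R n.+1)
  ((2 * x) `^ x * g t))).
  apply: le_Rintegral => //.
  - by apply: integrable_itvcc => //; exact: continuous_gamma_fun.
  - apply: integrable_itvcc => // t t0.
    by apply: continuousM; [exact: cst_continuous | exact: cg].
  - move=> t; rewrite /exhaust_itv/= in_itv/= => /andP[+ _] => it.
    by apply: gamma_fun_le => //; exact: le_trans it; exact: ltW.
rewrite RintegralZl//; last exact: integrable_itvcc.
rewrite mulrC; apply: ler_wpM2r; first exact: powR_ge0.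
have i1 := natSSinv_lt R n.
rewrite (Rintegral_continuous_FTC2 _ _ _ _ i1 cg (fun t _ => is_derive_expR_half t)).
(* The integral of [g] is twice a difference of two exponentials, the first at most 1 and the second
   nonnegative, hence at most 2 for every n. *)
have := expR_ge0 (- (n.+2%:R / 2) : R).
have : expR (- (n.+2%:R^-1 / 2)) <= 1 :> R.
  by rewrite expR_le1 oppr_le0 divr_ge0// ltW.
lra.
Qed.

Lemma gamma_part_parts {R : realType} (x : R) (n : nat) :
  x * gamma_part x n.+1 = gamma_part (x + 1) n.+1 +
    (gamma_fun (x + 1) n.+2%:R - gamma_fun (x + 1) n.+2%:R^-1).
Proof.
have i0 : 0 < n.+2%:R^-1 :> R by rewrite invr_gt0 ltr0n.
have mI : measurable (exhaust_itv R n.+1) by exact: measurable_itv.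
have cx (t : R) : 0 < t -> {for t, continuous (fun t => x * gamma_fun x t)}.
  move=> t0; apply: continuousM; first exact: cst_continuous.
  exact: continuous_gamma_fun.
have cx1 (t : R) : 0 < t -> {for t, continuous (gamma_fun (x + 1))}.
  exact: continuous_gamma_fun.
have i1 := natSSinv_lt R n.
have cd (t : R) : 0 < t ->
    {for t, continuous (fun t => x * gamma_fun x t - gamma_fun (x + 1) t)}.
  by move=> t0; apply: continuousB; [exact: cx|exact: cx1].
rewrite -(Rintegral_continuous_FTC2 _ _ _ _ i1 cd (is_derive_gamma_fun x)).
rewrite RintegralB//; [|exact: integrable_itvcc..].
rewrite RintegralZl//; last first.
  by apply: integrable_itvcc => //; exact: continuous_gamma_fun.
by rewrite addrC subrK.
Qed.

(** * Convergence of Euler's integral, functional equation and positivity *)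

(** The exponential majorant is only available at [x + 1]; integration by parts transfers the bound
    to x, which handles the singularity at 0 when x < 1. *)
Lemma gamma_part_cvg {R : realType} (x : R) : 0 < x ->
  gamma_part x n @[n --> \oo] --> Gamma x.
Proof.
move=> x0; have Ix := gamma_part_cvg_integral x.
(* [Gamma] is the [fine] part of this integral, and [fine] sends an infinite value to 0, so
   finiteness must come first. *)
suff fI : (\int[lebesgue_measure]_(t in `]0%R, +oo[) (gamma_fun x t)%:E)%E
    \is a fin_num.
  by have := Ix; rewrite -(fineK fI) => /fine_cvg; exact.
have cB : bounded_fun (fun n => gamma_fun (x + 1) n.+1%:R).
  by apply: cvg_seq_bounded; apply/cvg_ex; exists 0; exact: gamma_fun_cvgy.
have [M Mn] : exists M : R, forall n, gamma_fun (x + 1) n.+1%:R <= M.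
  have [M [_ /(_ (M + 1))]] := cB; rewrite ltrDl ltr01 => /(_ isT) h.
  by exists (M + 1) => n; apply: le_trans (h n I); exact: ler_norm.
rewrite ge0_fin_numE; last first.
  by apply: integral_ge0 => t _; rewrite lee_fin gamma_fun_ge0.
(* In [gamma_part_parts], the integral at [x + 1] is bounded by [gamma_part_succ_le] and the upper
   boundary term by [M]; the lower one is subtracted and nonnegative. *)
apply: (@le_lt_trans _ _ ((2 * (2 * x) `^ x + M) / x)%:E); last exact: ltry.
rewrite -(cvg_lim _ Ix)//; apply: lime_le; first by apply/cvg_ex; eexists; exact: Ix.
apply: near_inftyS; near=> n; rewrite lee_fin ler_pdivlMr// mulrC.
rewrite gamma_part_parts; apply: lerD; first exact: gamma_part_succ_le.
by rewrite lerBlDr -[leLHS]addr0 lerD// gamma_fun_ge0.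
Unshelve. all: by end_near. Qed.

Lemma GammaD1 {R : realType} (x : R) : 0 < x -> Gamma (x + 1) = x * Gamma x.
Proof.
move=> x0; have x10 : 0 < x + 1 by rewrite addr_gt0.
have l1 : x * gamma_part x n.+1 @[n --> \oo] --> x * Gamma x.
  by apply: cvgM; [exact: cvg_cst|]; rewrite (cvg_shiftS (gamma_part x)); exact: gamma_part_cvg.
(* The same sequence after integration by parts; the two zeros are the limits of the boundary terms
   at infinity and at 0. *)
have l2 : x * gamma_part x n.+1 @[n --> \oo] --> Gamma (x + 1) + (0 - 0).
  under eq_cvg do rewrite gamma_part_parts.
  apply: cvgD; first by rewrite (cvg_shiftS (gamma_part (x + 1))); exact: gamma_part_cvg.
  apply: cvgB.
    by rewrite (cvg_shiftS (fun n => gamma_fun (x + 1) n.+1%:R)); exact: gamma_fun_cvgy.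
  by rewrite (cvg_shiftS (fun n => gamma_fun (x + 1) n.+1%:R^-1)); exact: gamma_fun_cvg0.
have := cvg_unique _ l2 l1; rewrite subrr addr0; exact.
Qed.

Lemma Gamma_gt0 {R : realType} (x : R) : 0 < x -> 0 < Gamma x.
Proof.
move=> x0; have mI n : measurable (exhaust_itv R n) by exact: measurable_itv.
have l1 : gamma_part x 1 <= Gamma x.
  have G := gamma_part_cvg x x0.
  rewrite -(cvg_lim _ G)//; apply: limr_ge; first by apply/cvg_ex; eexists; exact: G.
  near=> n; rewrite -lee_fin !gamma_part_EFin; apply: ge0_subset_integral => //.
  - exact: mI.
  - exact: mI.
  - by apply/measurable_EFinP; exact: measurable_gamma_fun.
  - by move=> t _; rewrite lee_fin gamma_fun_ge0.
  - by rewrite -subsetEset; apply: nondecreasing_exhaust_itv; near: n; exists 1%N.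
apply: lt_le_trans l1.
(* A lower bound of the integrand on [1/2, 2]. Writing t^(x - 1) as t^x / t and bounding each factor
   avoids a case distinction on the sign of x - 1. *)
pose c : R := 2^-1 `^ x / 2 * expR (- 2).
have c0 : 0 < c by rewrite mulr_gt0 ?expR_gt0// divr_gt0// powR_gt0// invr_gt0.
apply: (@lt_le_trans _ _ (\int[lebesgue_measure]_(t in exhaust_itv R 1) c)).
  rewrite (Rintegral_cst lebesgue_measure (mI 1%N) c) mulr_gt0// /exhaust_itv.
  have h : 2^-1 < 2 :> R by lra.
  by rewrite /= lebesgue_measure_itv/= lte_fin h/= subr_gt0.
apply: le_Rintegral => //.
- exact: mI.
- by apply: integrable_itvcc => // t _; exact: cst_continuous.
- by apply: integrable_itvcc => //; exact: continuous_gamma_fun.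
move=> t; rewrite /exhaust_itv/= in_itv/= => /andP[t1 t2].
have t0 : 0 < t by apply: lt_le_trans t1; rewrite invr_gt0.
rewrite /c /gamma_fun ler_pM ?expR_ge0 ?divr_ge0 ?powR_ge0//; last first.
  by rewrite ler_expR lerN2.
rewrite powRB; last by rewrite (gt_eqF t0) implybT.
rewrite powRr1 ?(ltW t0)// ler_pM ?powR_ge0 ?invr_ge0//.
  by apply: ge0_ler_powR; rewrite ?nnegrE ?invr_ge0 ?(ltW x0) ?(ltW t0).
by rewrite lef_pV2 ?posrE.
Unshelve. all: by end_near. Qed.

(** * Pochhammer symbols and comparison of the two weights *)

Lemma Gamma_pochhammer {R : realType} (nu : R) (k : nat) : 0 < nu ->
  Gamma (nu + k%:R) = pochhammer nu k * Gamma nu.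
Proof.
move=> nu0; rewrite /pochhammer; elim: k => [|k IHk].
  by rewrite addr0 big_ord0 mul1r.
rewrite -natr1 addrA GammaD1; last by rewrite ltr_wpDr.
by rewrite IHk big_ord_recr/= mulrA [X in X * _]mulrC.
Qed.

Lemma pochhammer_gt0 {R : realType} (nu : R) (k : nat) : 0 < nu ->
  0 < pochhammer nu k.
Proof. by move=> nu0; apply: prodr_gt0 => i _; rewrite ltr_wpDr. Qed.

Lemma ecomp_weight_gt0 {R : realType} (nu p alpha beta : R) (k : nat) :
  0 < nu -> 0 < p -> 0 < ecomp_weight nu p alpha beta k.
Proof.
move=> nu0 p0; rewrite /ecomp_weight mulr_gt0 ?exprn_gt0// divr_gt0//.
exact/powR_gt0/pochhammer_gt0.
Qed.

Lemma gcomp_weight_gt0 {R : realType} (nu p beta : R) (k : nat) :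
  0 < nu -> 0 < p -> 0 < gcomp_weight nu p beta k.
Proof.
move=> nu0 p0; rewrite /gcomp_weight mulr_gt0 ?exprn_gt0// divr_gt0//.
by apply/powR_gt0/Gamma_gt0; rewrite ltr_wpDr.
Qed.

Lemma gcomp_weightE {R : realType} (nu p alpha beta : R) (k : nat) : 0 < nu ->
  gcomp_weight nu p beta k =
  Gamma nu `^ beta * k`!%:R `^ (alpha - 1) * ecomp_weight nu p alpha beta k.
Proof.
move=> nu0; have k0 : 0 < k`!%:R :> R by rewrite ltr0n fact_gt0.
rewrite /gcomp_weight /ecomp_weight Gamma_pochhammer//.
rewrite powRM ?ltW ?pochhammer_gt0 ?Gamma_gt0// powRB; last first.
  by rewrite (gt_eqF k0) implybT.
rewrite powRr1 ?(ltW k0)//; field.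
by rewrite !gt_eqF// powR_gt0.
Qed.

(** * Positivity of the normalizing constants, and the likelihood ratio *)

(** Otherwise the whole space would be a countable union of null fibres of [X], against its total
    mass 1. *)
Lemma npmf_neq0 {d : measure_display} {T : measurableType d} {R : realType}
  (P : probability T R) (X : {RV P >-> nat}) : exists k, npmf X k != 0.
Proof.
apply: contrapT => /forallNP X0.
have PX k : (P (X @^-1` [set k]) = 0)%E.
  have /negP/negPn/eqP := X0 k; rewrite /npmf => /eqP.
  by rewrite fine_eq0 ?fin_num_measure// => [/eqP //|]; exact: measurable_funPTI.
have /negligibleP : P.-negligible [set: T].
  have -> : [set: T] = \bigcup_k X @^-1` [set k].
    by apply/seteqP; split=> // t _; exists (X t).
  apply: negligible_bigcup => k; apply/negligibleP; last exact: PX.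
  exact: measurable_funPTI.
by move=> /(_ measurableT) /eqP; rewrite [X in X == _](probability_setT P) onee_eq0.
Qed.

(* Normalizing constants need not be shown finite: a zero one (the junk value of
   a divergent limit included) would make all the probabilities vanish. *)
Lemma npmf_normalization {d : measure_display} {T : measurableType d}
  {R : realType} (P : probability T R) (X : {RV P >-> nat}) (w : nat -> R)
  (S : R) :
  (forall k, 0 < w k) -> (forall k, npmf X k = w k / S) -> 0 < S.
Proof.
move=> w0 Xw; have [k Xk] := npmf_neq0 P X.
have : 0 < npmf X k by rewrite lt0r Xk/= /npmf fine_ge0.
by rewrite Xw pmulr_rgt0// invr_gt0.
Qed.

Theorem theorem2 (R : realType) (d1 d2 : measure_display)
    (T1 : measurableType d1) (T2 : measurableType d2)
    (P1 : probability T1 R) (P2 : probability T2 R)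
    (X : {RV P1 >-> nat}) (Y : {RV P2 >-> nat})
    (nu p alpha beta : R)
    (nu_gt0 : 0 < nu) (p_gt0 : 0 < p)
    (ecomp_adm : beta < alpha \/ (alpha = beta /\ p < 1))
    (gcomp_adm : beta < 1 \/ (beta = 1 /\ p < 1))
    (X_law : has_ecomp_law X nu p alpha beta)
    (Y_law : has_gcomp_law Y nu p beta)
    (alpha_gt1 : 1 < alpha) :
  lr_le X Y.
Proof.
have e0 k : 0 < ecomp_weight nu p alpha beta k by exact: ecomp_weight_gt0.
have g0 k : 0 < gcomp_weight nu p beta k by exact: gcomp_weight_gt0.
have := npmf_normalization P1 X _ _ e0 X_law.
have := npmf_normalization P2 Y _ _ g0 Y_law.
move: X_law Y_law; rewrite /has_ecomp_law /has_gcomp_law /ecomp_pmf /gcomp_pmf.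
set SX := limn _; set SY := limn _ => X_law Y_law SY0 SX0.
split=> [n|n|m n mn]; rewrite /= ?X_law ?Y_law ?divr_gt0//.
(* By [gcomp_weightE] the ECOMP weight cancels, and k enters only through the power of k!. *)
have ratioE k : gcomp_weight nu p beta k / SY / (ecomp_weight nu p alpha beta k / SX)
    = Gamma nu `^ beta * SX / SY * k`!%:R `^ (alpha - 1).
  rewrite (gcomp_weightE _ _ alpha)//; field.
  by rewrite !gt_eqF.
rewrite !ratioE ler_pM2l; last by rewrite !mulr_gt0 ?invr_gt0//; exact/powR_gt0/Gamma_gt0.
apply: ge0_ler_powR; rewrite ?nnegrE ?ler0n ?subr_ge0 ?(ltW alpha_gt1)//.
by rewrite ler_nat leq_fact.
Qed.
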